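(* Let $\mathbf{G}$ be a categorical group with source map $s$ and target map $t$, and let $(G,H,\alpha,\tau)$ be the associated crossed module; write $K=\mathrm{Mor}(\mathbf{G})$, so that $G=\mathrm{Obj}(\mathbf{G})$. Suppose $\rho$ is a representation of $\mathbf{G}$ on a categorical vector space $\mathbf{V}$. Let $V=\mathrm{Obj}(\mathbf{V})$, let $W=\ker\bigl(s:\mathrm{Mor}(\mathbf{V})\to\mathrm{Obj}(\mathbf{V})\bigr)$, and let $\tau_0:W\to V$ be the restriction to $W$ of the target map of $\mathbf{V}$. Then there is a representation $\rho_0$ of $G$ on $W$ such that $$\rho(k)w=\rho_0\bigl(t(k)\bigr)w\qquad\text{for all } w\in W\text{ and } k\in K,$$ and $\rho_0$ intertwines with $\rho|_G$ through the map $\tau_0$: $$\tau_0\bigl(\rho_0(t(k))w\bigr)=\rho\bigl(t(k)\bigr)\tau_0(w)\qquad\text{for all } k\in K\text{ and } w\in W.$$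
   Context: A categorical group $\mathbf{G}$ is a category with a bifunctor $\otimes:\mathbf{G}\times\mathbf{G}\to\mathbf{G}$ (written as juxtaposition) such that $\mathrm{Obj}(\mathbf{G})$ and $\mathrm{Mor}(\mathbf{G})$ are both groups under $\otimes$; $e$ is the identity of $\mathrm{Obj}(\mathbf{G})$ and $1_x$ the identity morphism at $x$. Its associated crossed module is $(G,H,\alpha,\tau)$ with $G=\mathrm{Obj}(\mathbf{G})$, $H=\ker(s:\mathrm{Mor}(\mathbf{G})\to\mathrm{Obj}(\mathbf{G}))$, $\alpha(g)(h)=1_gh1_{g^{-1}}$, and $\tau=t|_H$. A categorical vector space over a field $\mathbb{F}$ is a category $\mathbf{V}$ whose object set and morphism set are vector spaces over $\mathbb{F}$, such that the source map, the target map and the identity-assigning map $x\mapsto 1_x$ are linear, and for all morphisms for which $f'\circ f$ and $g'\circ g$ are defined, $(f'+g')\circ(f+g)=f'\circ f+g'\circ g$ and (functoriality of multiplication by scalars $\lambda\in\mathbb{F}$, as printed in the paper) $(\lambda f')\circ f=\lambda(f'\circ f)=f'\circ(\lambda f)$ (whenever these composites are defined). A representation (without twist) of $\mathbf{G}$ on $\mathbf{V}$ is a functor $\rho:\mathbf{G}\times\mathbf{V}\to\mathbf{V}$ such that $\rho(k',\rho(k,f))=\rho(k'k,f)$ and $\rho(1_e,f)=f$ for all $k,k'\in\mathrm{Mor}(\mathbf{G})$, $f\in\mathrm{Mor}(\mathbf{V})$, and such that $\rho(g):v\mapsto\rho(g,v)$ on $\mathrm{Obj}(\mathbf{V})$ and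 $\rho(k):f\mapsto\rho(k,f)$ on $\mathrm{Mor}(\mathbf{V})$ are linear for all $g\in\mathrm{Obj}(\mathbf{G})$, $k\in\mathrm{Mor}(\mathbf{G})$. The letter $\rho$ denotes both the representation of $K=\mathrm{Mor}(\mathbf{G})$ on $\mathrm{Mor}(\mathbf{V})$ and the representation $\rho|_G$ of $G$ on $V$. The letters $s,t$ denote source and target maps both in $\mathbf{G}$ and in $\mathbf{V}$. *)

(* Defs.v *)
From HB Require Import structures.
From mathcomp Require Import all_boot all_algebra.

Set Implicit Arguments.
Unset Strict Implicit.
Unset Printing Implicit Defensive.

Import GRing.Theory.
Local Open Scope ring_scope.

(* A small category with object set O and morphism set M.  Composition is a
   total function, but it is constrained only on composable pairs; its values
   elsewhere are irrelevant. *)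
Record category (O M : Type) := Category {
  src : M -> O;
  tgt : M -> O;
  idm : O -> M;
  compose : M -> M -> M;
  src_idm : forall x, src (idm x) = x;
  tgt_idm : forall x, tgt (idm x) = x;
  src_compose : forall f' f, src f' = tgt f -> src (compose f' f) = src f;
  tgt_compose : forall f' f, src f' = tgt f -> tgt (compose f' f) = tgt f';
  compose_idr : forall f, compose f (idm (src f)) = f;
  compose_idl : forall f, compose (idm (tgt f)) f = f;
  composeA : forall f'' f' f, src f'' = tgt f' -> src f' = tgt f ->
    compose f'' (compose f' f) = compose (compose f'' f') f
}.

Section ProductCategory.
Variables (O1 M1 O2 M2 : Type) (C1 : category O1 M1) (C2 : category O2 M2).

Definition prod_category : category (O1 * O2) (M1 * M2).
Proof.
refine (@Category _ _
  (fun f => (src C1 f.1, src C2 f.2))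
  (fun f => (tgt C1 f.1, tgt C2 f.2))
  (fun x => (idm C1 x.1, idm C2 x.2))
  (fun f' f => (compose C1 f'.1 f.1, compose C2 f'.2 f.2))
  _ _ _ _ _ _ _).
- by case=> x1 x2; rewrite /= !src_idm.
- by case=> x1 x2; rewrite /= !tgt_idm.
- by move=> f' f [h1 h2]; rewrite /= !src_compose.
- by move=> f' f [h1 h2]; rewrite /= !tgt_compose.
- by case=> f1 f2; rewrite /= !compose_idr.
- by case=> f1 f2; rewrite /= !compose_idl.
- by move=> f'' f' f [h1 h2] [h3 h4]; rewrite /= !composeA.
Defined.

End ProductCategory.

Record is_functor (O1 M1 O2 M2 : Type) (C : category O1 M1)
    (D : category O2 M2) (F0 : O1 -> O2) (F1 : M1 -> M2) : Prop := IsFunctor {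
  functor_src : forall f, src D (F1 f) = F0 (src C f);
  functor_tgt : forall f, tgt D (F1 f) = F0 (tgt C f);
  functor_idm : forall x, F1 (idm C x) = idm D (F0 x);
  functor_compose : forall f' f, src C f' = tgt C f ->
    F1 (compose C f' f) = compose D (F1 f') (F1 f)
}.

Record cat_group := CatGroup {
  gobj : groupType;
  gmor : groupType;
  gcat :> category gobj gmor;
  gtensor : is_functor (prod_category gcat gcat) gcat
    (fun x => (x.1 * x.2)%g) (fun k => (k.1 * k.2)%g)
}.

(* Scalar multiplication by each a is compatible with composition. *)
Definition scale_functorial (F : fieldType) (V M : lmodType F)
    (C : category V M) : Prop :=
  forall (a : F) f' f, src C f' = tgt C f ->
    compose C (a *: f') (a *: f) = a *: compose C f' f.

(* The printed form (a f') o f = a (f' o f) = f' o (a f), imposed when all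
   three composites are defined. *)
Definition scale_printed (F : fieldType) (V M : lmodType F)
    (C : category V M) : Prop :=
  forall (a : F) f' f,
    src C f' = tgt C f -> src C (a *: f') = tgt C f ->
    src C f' = tgt C (a *: f) ->
    compose C (a *: f') f = a *: compose C f' f /\
    a *: compose C f' f = compose C f' (a *: f).

Definition compose_additive (F : fieldType) (V M : lmodType F)
    (C : category V M) : Prop :=
  forall f' f g' g, src C f' = tgt C f -> src C g' = tgt C g ->
    compose C (f' + g') (f + g) = compose C f' f + compose C g' g.

(* The scalar law is taken in the form scale_functorial.  The printed form is
   a misprint: by scale_printed_degenerate below it leaves no nonzero morphism
   of source 0.  No categorical vector space in the printed sense is lost: see
   cat_vect_of_printed. *)
Record cat_vect (F : fieldType) := CatVect {
  vobj : lmodType F;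
  vmor : lmodType F;
  vcat :> category vobj vmor;
  src_linear : linear (src vcat);
  tgt_linear : linear (tgt vcat);
  idm_linear : linear (idm vcat);
  vcompose_add : compose_additive vcat;
  vcompose_scale : scale_functorial vcat
}.

Section ScalarLaws.
Variables (F : fieldType) (V M : lmodType F) (C : category V M).
Hypotheses (src_lin : linear (src C)) (tgt_lin : linear (tgt C)).
Hypotheses (idm_lin : linear (idm C)) (comp_add : compose_additive C).

Let lin0 (A B : lmodType F) (h : A -> B) : linear h -> h 0 = 0.
Proof.
by move=> hl; have:= hl (-1) 0 0; rewrite scaler0 addr0 scaleN1r addNr.
Qed.

Let linZ (A B : lmodType F) (h : A -> B) a x :
  linear h -> h (a *: x) = a *: h x.
Proof.
by move=> hl; have:= hl a x 0; rewrite !addr0 (lin0 hl) addr0.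
Qed.

Let linB (A B : lmodType F) (h : A -> B) x y :
  linear h -> h (x - y) = h x - h y.
Proof. by move=> hl; rewrite addrC -scaleN1r hl scaleN1r addrC. Qed.

Lemma composeE f' f : src C f' = tgt C f ->
  compose C f' f = f' - idm C (tgt C f) + f.
Proof.
move=> ff'; set i := idm C (tgt C f).
have s0 : src C (f' - i) = 0 by rewrite (linB _ _ src_lin) src_idm ff' subrr.
have i0 : idm C 0 = 0 by exact: lin0.
rewrite -{1}[f'](subrK i) -{1}[f]add0r comp_add.
- by rewrite compose_idl -{1}i0 -s0 compose_idr.
- by rewrite s0 (lin0 tgt_lin).
- by rewrite src_idm.
Qed.

Lemma additive_scale_functorial : scale_functorial C.
Proof.
move=> a f' f ff'.
rewrite !composeE ?(linZ _ _ src_lin) ?(linZ _ _ tgt_lin) ?ff' //.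
by rewrite (linZ _ _ idm_lin) scalerDr scalerBr.
Qed.

Definition cat_vect_of_printed (_ : scale_printed C) : cat_vect F :=
  CatVect src_lin tgt_lin idm_lin comp_add additive_scale_functorial.

Lemma scale_printed_degenerate :
  scale_printed C -> forall w, src C w = 0 -> w = 0.
Proof.
move=> sc w w0; have t0 := lin0 tgt_lin.
have [||| _] := sc 0 w 0; rewrite ?scale0r ?scaler0 ?w0 ?t0 //.
  exact: lin0.
by have:= compose_idr C w; rewrite w0 (lin0 idm_lin) => -> ->.
Qed.

End ScalarLaws.

(* A representation of G on V: a functor from the product category G x V
   to V satisfying the action laws on morphisms, linear in the second slot. *)
Record cat_repr (F : fieldType) (G : cat_group) (V : cat_vect F) := CatRepr {
  rho_obj : gobj G -> vobj V -> vobj V;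
  rho_mor : gmor G -> vmor V -> vmor V;
  rho_functor : is_functor (prod_category G V) V
    (fun x => rho_obj x.1 x.2) (fun f => rho_mor f.1 f.2);
  rho_morM : forall k' k f, rho_mor k' (rho_mor k f) = rho_mor (k' * k)%g f;
  rho_mor1 : forall f, rho_mor (idm G 1%g) f = f;
  rho_obj_linear : forall g, linear (rho_obj g);
  rho_mor_linear : forall k, linear (rho_mor k)
}.

Record lin_repr (F : fieldType) (G : groupType) (W : lmodType F) := LinRepr {
  lin_act :> G -> {linear W -> W};
  lin_act1 : forall w, lin_act 1%g w = w;
  lin_actM : forall g h w, lin_act (g * h)%g w = lin_act g (lin_act h w)
}.

Section SourceKernel.
Variables (F : fieldType) (V : cat_vect F).

Definition src_ker : {pred vmor V} := fun w => src V w == 0.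

Lemma src_ker_submod : submod_closed src_ker.
Proof.
have s0 : src V 0 = 0.
  have := @src_linear F V (-1) 0 0.
  by rewrite scaler0 addr0 scaleN1r addNr.
split=> [|a u v]; rewrite !unfold_in /src_ker ?s0 // => /eqP u0 /eqP v0.
by rewrite src_linear u0 v0 scaler0 addr0.
Qed.
HB.instance Definition _ :=
  GRing.isSubmodClosed.Build F (vmor V) src_ker src_ker_submod.

Record kerW := KerW { kerW_val :> vmor V; _ : kerW_val \in src_ker }.
HB.instance Definition _ := [isSub for kerW_val].
HB.instance Definition _ := [Choice of kerW by <:].
HB.instance Definition _ := [SubChoice_isSubLmodule of kerW by <:].

Definition tau0 (w : kerW) : vobj V := tgt V (kerW_val w).

Lemma tau0_linear : linear tau0.
Proof. by move=> a u v; rewrite /tau0 -tgt_linear. Qed.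
HB.instance Definition _ :=
  GRing.isLinear.Build F kerW (vobj V) *:%R tau0 tau0_linear.

End SourceKernel.

(* Main.v *)
Require Import Defs.
From HB Require Import structures.
From mathcomp Require Import all_boot all_algebra.

Set Implicit Arguments.
Unset Strict Implicit.
Unset Printing Implicit Defensive.

Import GRing.Theory.
Local Open Scope ring_scope.

(** In the product category, (k, w) factors as (1_(t k), w) o (k, 1_(s w)).
    When s w = 0, the identity at s w is the zero morphism, so functoriality
    gives rho(k) w = rho(1_(t k)) w o rho(k) 0.  Linearity of rho(k) turns the
    right factor into the zero morphism, which is the identity at 0, the
    source of the left factor.  Hence rho(k) w = rho(1_(t k)) w
    ([rho_mor_src_ker]): on W the action of k depends on t(k) only, and rho0
    is forced to be g |-> rho(1_g).  This is a representation because g |-> 1_g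
    is a group morphism, and the intertwining relation is the compatibility of
    the functor rho with targets. *)

Lemma linear_eq0 (F : fieldType) (A B : lmodType F) (h : A -> B) :
  linear h -> h 0 = 0.
Proof.
by move=> hl; have := hl (-1) 0 0; rewrite scaler0 addr0 scaleN1r addNr.
Qed.

Lemma idm_tensor (G : cat_group) (g h : gobj G) :
  idm G (g * h)%g = (idm G g * idm G h)%g.
Proof. by rewrite -(functor_idm (gtensor G) (g, h)). Qed.

Section KernelRepresentation.
Variables (F : fieldType) (G : cat_group) (V : cat_vect F).
Variable rho : cat_repr G V.

Lemma src_rho_mor k w : src V (rho_mor rho k w) = rho_obj rho (src G k) (src V w).
Proof. exact: functor_src (rho_functor rho) (k, w). Qed.

Lemma tgt_rho_mor k w : tgt V (rho_mor rho k w) = rho_obj rho (tgt G k) (tgt V w).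
Proof. exact: functor_tgt (rho_functor rho) (k, w). Qed.

Lemma rho_mor_compose k' k f' f : src G k' = tgt G k -> src V f' = tgt V f ->
  rho_mor rho (compose G k' k) (compose V f' f) =
  compose V (rho_mor rho k' f') (rho_mor rho k f).
Proof.
move=> kk ff; apply: (functor_compose (rho_functor rho) (f' := (k', f')) (f := (k, f))).
by rewrite /= kk ff.
Qed.

Lemma src_rho_mor_ker k w :
  src V w = 0 -> src V (rho_mor rho k w) = 0.
Proof. by move=> w0; rewrite src_rho_mor w0 (linear_eq0 (rho_obj_linear _ _)). Qed.

(** The zero morphism serves twice as the identity at the zero object: it lets
    w be written as w o 0, and, since rho(k) sends it to itself, it disappears
    again after functoriality has been applied. *)
Lemma rho_mor_src_ker k w : src V w = 0 ->
  rho_mor rho k w = rho_mor rho (idm G (tgt G k)) w.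
Proof.
move=> w0; have i0 : idm V 0 = 0 := linear_eq0 (@idm_linear _ V).
have t0 : tgt V 0 = 0 := linear_eq0 (@tgt_linear _ V).
have compose0 f : src V f = 0 -> compose V f 0 = f.
  by move=> f0; have := compose_idr V f; rewrite f0 i0.
rewrite -{1}(compose_idl G k) -{1}(compose0 w w0).
rewrite rho_mor_compose ?src_idm ?w0 ?t0 //.
by rewrite (linear_eq0 (rho_mor_linear _ _)) compose0 // src_rho_mor_ker.
Qed.

Lemma rho_ker_subproof g (w : kerW V) :
  rho_mor rho (idm G g) (kerW_val w) \in @src_ker F V.
Proof.
by case: w => w /= /eqP w0; rewrite unfold_in; apply/eqP/src_rho_mor_ker.
Qed.

Definition rho_ker g (w : kerW V) : kerW V := KerW (rho_ker_subproof g w).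

Lemma rho_ker_linear g : linear (rho_ker g).
Proof. by move=> a u v; apply: val_inj; rewrite /= rho_mor_linear. Qed.

HB.instance Definition _ g :=
  GRing.isLinear.Build F (kerW V) (kerW V) *:%R (rho_ker g) (rho_ker_linear g).

Lemma rho_ker1 w : rho_ker 1%g w = w.
Proof. by apply: val_inj; rewrite /= rho_mor1. Qed.

Lemma rho_kerM g h w : rho_ker (g * h)%g w = rho_ker g (rho_ker h w).
Proof. by apply: val_inj; rewrite /= rho_morM idm_tensor. Qed.

Definition rho_ker_repr : lin_repr (gobj G) (kerW V) :=
  LinRepr (lin_act := fun g => rho_ker g) rho_ker1 rho_kerM.

End KernelRepresentation.

Theorem proposition9p2 (F : fieldType) (G : cat_group) (V : cat_vect F)
    (rho : cat_repr G V) :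
  exists rho0 : lin_repr (gobj G) (kerW V),
    (forall (w : kerW V) (k : gmor G),
       rho_mor rho k (kerW_val w) = kerW_val (rho0 (tgt G k) w)) /\
    (forall (k : gmor G) (w : kerW V),
       tau0 (rho0 (tgt G k) w) = rho_obj rho (tgt G k) (tau0 w)).
Proof.
exists (rho_ker_repr rho); split=> [[w /= /eqP w0] k | k w].
  exact: rho_mor_src_ker.
by rewrite /tau0 /= tgt_rho_mor tgt_idm.
Qed.
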